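(* Let $G=\mathbb Z^{<\mathbb N}$ and let $H$, $\pi_0:H\to G$ be the group and surjective homomorphism defined in the context. Then the pair $\{H,\pi_0\}$ is a universal resolution of the third cocycle group $\mathrm Z^3(G,\mathbb T)$ of $G$, i.e. $\pi_0^*(\mathrm Z^3(G,\mathbb T))\subset \mathrm B^3(H,\mathbb T)$. Consequently, if $K$ is a countable discrete abelian group, then for any surjective homomorphism $\pi:\mathbb Z^{<\mathbb N}\to K$ the composed map $\pi_K=\pi\circ\pi_0:H\to K$ makes the pair $\{H,\pi_K\}$ a universal resolution of the third cocycle group $\mathrm Z^3(K,\mathbb T)$, i.e. $\pi_K^*(\mathrm Z^3(K,\mathbb T))\subset\mathrm B^3(H,\mathbb T)$.
   Context: $G=\mathbb Z^{<\mathbb N}$ is the free abelian group of finitely supported integer sequences, with standard basis $\{a_i:i\in\mathbb N\}$ and coordinates $e_i$: $g=\sum_i e_i(g)a_i$. $M$ is the additive group of integer-valued strictly upper triangular matrices $m=(m_{jk})_{j<k}$, $j,k\in\mathbb N$, with finitely many nonzero entries. Define $\mathfrak n_M:G\times G\to M$ by letting its $(j,k)$-entry, $j<k$, be $e_j(g)e_k(h)$. $H=M\times_{\mathfrak n_M}G$ is the set $M\times G$ with group law $$(m,g)(n,h)=(m+n+\mathfrak n_M(g;h),\,g+h),$$ and $\pi_0(m,g)=g$. $\mathrm Z^3(K,\mathbb T)$ and $\mathrm B^3(K,\mathbb T)$ are the groups of $\mathbb T$-valued 3-cocycles and 3-coboundaries for the trivial action. For a countable discrete group $K$, a pair $\{H,\pi\}$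 of a countable discrete amenable group $H$ and a surjective homomorphism $\pi:H\to K$ is a universal resolution of $\mathrm Z^3(K,\mathbb T)$ if $\pi^*(\mathrm Z^3(K,\mathbb T))\subset\mathrm B^3(H,\mathbb T)$. *)

(* Defs.v *)
From HB Require Import structures.
From mathcomp Require Import all_boot all_order all_algebra.
From mathcomp Require Import complex.
From mathcomp Require Import all_classical all_reals all_analysis.

Set Implicit Arguments.
Unset Strict Implicit.
Unset Printing Implicit Defensive.

Import Order.TTheory GRing.Theory Num.Theory.
Import numFieldNormedType.Exports.

Local Open Scope classical_set_scope.
Local Open Scope ring_scope.

(* The circle group T: the complex numbers of modulus 1, under
   multiplication. *)
Section Circle.
Variable R : realType.

Record circle := Circle {
  circle_val :> R[i];
  circle_normP : `|circle_val| == 1 }.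

HB.instance Definition _ := [isSub for circle_val].
HB.instance Definition _ := [Choice of circle by <:].

Lemma circle_neq0 (z : circle) : (z : R[i]) != 0.
Proof. by rewrite -normr_eq0 (eqP (circle_normP z)) oner_eq0. Qed.

Fact circle_one_subproof : `|1 : R[i]| == 1.
Proof. by rewrite normr1. Qed.

Fact circle_mul_subproof (z w : circle) : `|(z : R[i]) * w| == 1.
Proof.
by rewrite normrM (eqP (circle_normP z)) (eqP (circle_normP w)) mulr1.
Qed.

Fact circle_inv_subproof (z : circle) : `|(z : R[i])^-1| == 1.
Proof. by rewrite normfV (eqP (circle_normP z)) invr1. Qed.

Definition circle_one := Circle circle_one_subproof.
Definition circle_mul z w := Circle (circle_mul_subproof z w).
Definition circle_inv z := Circle (circle_inv_subproof z).

Fact circle_mulA : associative circle_mul.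
Proof. by move=> x y z; apply: val_inj; rewrite /= mulrA. Qed.
Fact circle_mul1 : left_id circle_one circle_mul.
Proof. by move=> x; apply: val_inj; rewrite /= mul1r. Qed.
Fact circle_mulr1 : right_id circle_one circle_mul.
Proof. by move=> x; apply: val_inj; rewrite /= mulr1. Qed.
Fact circle_mulV : left_inverse circle_one circle_inv circle_mul.
Proof. by move=> x; apply: val_inj; rewrite /= mulVf ?circle_neq0. Qed.
Fact circle_mulrV : right_inverse circle_one circle_inv circle_mul.
Proof. by move=> x; apply: val_inj; rewrite /= mulfV ?circle_neq0. Qed.

HB.instance Definition _ := isGroup.Build circle
  circle_mulA circle_mul1 circle_mulr1 circle_mulV circle_mulrV.

Lemma circle_mulC : commutative ( *%g : circle -> circle -> circle).
Proof. by move=> x y; apply: val_inj; rewrite /= mulrC. Qed.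

End Circle.

Section Cohomology.
Variables (R : realType).
Local Open Scope group_scope.
Local Notation T := (circle R).

(* Cocycles and coboundaries are not required to be normalized. *)
Definition cobound2 (K : groupType) (b : K -> K -> T) (p q r : K) : T :=
  b q r * (b (p * q) r)^-1 * b p (q * r) * (b p q)^-1.

Definition cobound3 (K : groupType) (c : K -> K -> K -> T) (p q r s : K) : T :=
  c q r s * (c (p * q) r s)^-1 * c p (q * r) s * (c p q (r * s))^-1 * c p q r.

Definition Z3 (K : groupType) : set (K -> K -> K -> T) :=
  [set c | forall p q r s, cobound3 c p q r s = 1].

Definition B3 (K : groupType) : set (K -> K -> K -> T) :=
  range (@cobound2 K).

Definition pullback3 (H K : Type) (pi : H -> K) (c : K -> K -> K -> T) :
  H -> H -> H -> T := fun p q r => c (pi p) (pi q) (pi r).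

End Cohomology.

Section Amenable.
Variable R : realType.

Definition left_invariant_mean (H : groupType) (mu : (H -> R) -> R) : Prop :=
  [/\ mu (cst 1) = 1,
      forall f : H -> R, bounded_fun f -> (forall x, 0 <= f x) -> 0 <= mu f,
      forall (a : R) (f g : H -> R), bounded_fun f -> bounded_fun g ->
        mu (fun x => a * f x + g x) = a * mu f + mu g
    & forall (h : H) (f : H -> R), bounded_fun f ->
        mu (fun x => f (h * x)%g) = mu f].

(* Amenability of H as a discrete group; only the values of mu on the bounded
   functions matter. *)
Definition amenable (H : groupType) : Prop :=
  exists mu, @left_invariant_mean H mu.

Definition universal_resolution (H K : groupType) (pi : H -> K) : Prop :=
  [/\ countable [set: H],
      amenable H,
      {morph pi : x y / (x * y)%g >-> (x * y)%g},
      set_surj [set: H] [set: K] pi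
    & pullback3 pi @` @Z3 R K `<=` @B3 R H].

End Amenable.

Section FreeAbelian.

Definition finsupp_seq : {pred nat -> int} :=
  fun g => `[< finite_set [set i | g i != 0] >].

Fact finsupp_seq_zmod_closed : zmod_closed finsupp_seq.
Proof.
split=> [|g h /asboolP fg /asboolP fh]; apply/asboolP.
  by apply: (sub_finite_set _ (@finite_set0 nat)) => i /negP[].
apply: (sub_finite_set _ (_ : finite_set ([set i | g i != 0] `|` [set i | h i != 0]))).
  move=> i /=; rewrite !fctE => gh; case: (eqVneq (g i) 0) => gi; last by left.
  by right; apply: contra gh => /eqP ->; rewrite gi subr0.
by rewrite finite_setU.
Qed.

HB.instance Definition _ :=
  GRing.isZmodClosed.Build (nat -> int) finsupp_seq finsupp_seq_zmod_closed.

(* The group Z^{<N}; the coordinate e_i(g) is [g i]. *)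
Record finZseq := FinZseq {
  finZseq_val :> nat -> int;
  finZseqP : finZseq_val \in finsupp_seq }.

HB.instance Definition _ := [isSub for finZseq_val].
HB.instance Definition _ := [Choice of finZseq by <:].
HB.instance Definition _ := [SubChoice_isSubZmodule of finZseq by <:].

End FreeAbelian.

Section UpperMatrices.

Definition finsupp_upper : {pred nat -> nat -> int} := fun m =>
  `[< (forall j k, (k <= j)%N -> m j k = 0) /\
      finite_set [set jk : nat * nat | m jk.1 jk.2 != 0] >].

Fact finsupp_upper_zmod_closed : zmod_closed finsupp_upper.
Proof.
split=> [|m n /asboolP[um fm] /asboolP[un fn]]; apply/asboolP; split => //.
- by apply: (sub_finite_set _ (@finite_set0 (nat * nat))) => i /negP[].
- by move=> j k kj; rewrite !fctE um// un// subr0.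
apply: (sub_finite_set _ (_ : finite_set
    ([set i | m i.1 i.2 != 0] `|` [set i | n i.1 i.2 != 0]))).
  move=> i /=; rewrite !fctE => mn.
  case: (eqVneq (m i.1 i.2) 0) => mi; last by left.
  by right; apply: contra mn => /eqP ->; rewrite mi subr0.
by rewrite finite_setU.
Qed.

HB.instance Definition _ := GRing.isZmodClosed.Build (nat -> nat -> int)
  finsupp_upper finsupp_upper_zmod_closed.

Record upperZmx := UpperZmx {
  upperZmx_val :> nat -> nat -> int;
  upperZmxP : upperZmx_val \in finsupp_upper }.

HB.instance Definition _ := [isSub for upperZmx_val].
HB.instance Definition _ := [Choice of upperZmx by <:].
HB.instance Definition _ := [SubChoice_isSubZmodule of upperZmx by <:].

End UpperMatrices.

Section Extension.
Implicit Types g h : finZseq.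

Fact nM_subproof g h :
  (fun j k : nat => if (j < k)%N then g j * h k else 0) \in finsupp_upper.
Proof.
apply/asboolP; split=> [j k|]; first by rewrite ltnNge => ->.
apply: (sub_finite_set _ (_ : finite_set
    ([set i | g i != 0] `*` [set i | h i != 0]))).
  move=> [j k] /=; case: ifP => _; last by rewrite eqxx.
  by rewrite mulf_eq0 negb_or => /andP[].
apply: finite_setX.
- by move: (finZseqP g) => /asboolP.
- by move: (finZseqP h) => /asboolP.
Qed.

Definition nM g h : upperZmx := UpperZmx (nM_subproof g h).

Lemma nMDl g1 g2 h : nM (g1 + g2) h = nM g1 h + nM g2 h.
Proof.
apply: val_inj; apply/funext => j; apply/funext => k /=; rewrite !fctE.
by case: ifP => _; rewrite ?addr0// mulrDl.
Qed.

Lemma nMDr g h1 h2 : nM g (h1 + h2) = nM g h1 + nM g h2.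
Proof.
apply: val_inj; apply/funext => j; apply/funext => k /=; rewrite !fctE.
by case: ifP => _; rewrite ?addr0// mulrDr.
Qed.

Lemma nM0l h : nM 0 h = 0.
Proof. by apply: (addrI (nM 0 h)); rewrite -nMDl !addr0. Qed.

Lemma nM0r g : nM g 0 = 0.
Proof. by apply: (addrI (nM g 0)); rewrite -nMDr !addr0. Qed.

Lemma nMNl g h : nM (- g) h = - nM g h.
Proof. by apply: (addrI (nM g h)); rewrite -nMDl !subrr nM0l. Qed.

Lemma nMNr g h : nM g (- h) = - nM g h.
Proof. by apply: (addrI (nM g h)); rewrite -nMDr !subrr nM0r. Qed.

(* The carrier of H = M x_{n_M} G. *)
Definition extH : Type := (upperZmx * finZseq)%type.
HB.instance Definition _ := Choice.on extH.

Definition extH_one : extH := (0, 0).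
Definition extH_mul (x y : extH) : extH :=
  (x.1 + y.1 + nM x.2 y.2, x.2 + y.2).
Definition extH_inv (x : extH) : extH := (nM x.2 x.2 - x.1, - x.2).

Fact extH_mulA : associative extH_mul.
Proof.
move=> [m g] [n h] [p k]; rewrite /extH_mul /= nMDl nMDr.
congr pair; last exact: addrA.
rewrite -!addrA; congr (_ + (_ + _)); rewrite [RHS]addrCA; congr (_ + _).
by rewrite [LHS]addrC addrA.
Qed.
Fact extH_mul1 : left_id extH_one extH_mul.
Proof. by move=> [m g]; rewrite /extH_mul /= nM0l addr0 !add0r. Qed.
Fact extH_mulr1 : right_id extH_one extH_mul.
Proof. by move=> [m g]; rewrite /extH_mul /= nM0r !addr0. Qed.
Fact extH_mulV : left_inverse extH_one extH_inv extH_mul.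
Proof. by move=> [m g]; rewrite /extH_mul /= nMNl subrK subrr addNr. Qed.
Fact extH_mulrV : right_inverse extH_one extH_inv extH_mul.
Proof.
by move=> [m g]; rewrite /extH_mul /= nMNr addrCA subrr addr0 !subrr.
Qed.

HB.instance Definition _ := isGroup.Build extH
  extH_mulA extH_mul1 extH_mulr1 extH_mulV extH_mulrV.

Definition pi0 (x : extH) : finZseq := x.2.

End Extension.

(* Main.v *)
(* Let t_i be translation by the i-th basis vector a_i of G, D_i = t_i - 1, and
   let delta be the bar differential. In the double complex of Koszul cochains
   with values in C^*(G; Fun(G, A)), a 3-cocycle c of G with values in an abelian
   group A descends by a zigzag
     D_i c = delta d_i,  D_i d_j - D_j d_i = delta u_ij,
     D_i u_jk - D_j u_ik + D_k u_ij = l_ijk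
   to constants l_ijk. The rows are exact, by an explicit contraction summing
   one coordinate at a time; climbing back shows that c is cohomologous to
     (p, q, r) |-> sum_(i < j < k) p_k q_j r_i l_ijk.
   On H the 2-cocycle (q, r) |-> q_j r_i is a coboundary, hence so is c.

   H is a central extension of G by M, so it is amenable once M and G are:
   average first over the fibres M, then over G. *)
From HB Require Import structures.
Require Import Defs.
From mathcomp Require Import all_boot all_order all_algebra.
From mathcomp Require Import all_classical all_reals all_analysis.
From mathcomp Require Import ring lra zify.
Set Implicit Arguments.
Unset Strict Implicit.
Unset Printing Implicit Defensive.
Import Order.TTheory GRing.Theory Num.Theory.
Import numFieldNormedType.Exports.
Local Open Scope classical_set_scope.
Local Open Scope ring_scope.

(* Z + A with A^2 = 0 is a commutative ring containing A; this makes [ring]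
   available for identities in the abelian group A. *)
Section SquareZero.
Variable A : zmodType.

Definition sqz : Type := (int * A)%type.
HB.instance Definition _ := GRing.Zmodule.on sqz.
Implicit Types x y z : sqz.

Definition sqz_one : sqz := (1, 0).
Definition sqz_mul x y : sqz := (x.1 * y.1, y.2 *~ x.1 + x.2 *~ y.1).

Fact sqz_mulA : associative sqz_mul.
Proof.
move=> [a u] [b v] [c w]; rewrite /sqz_mul /= mulrA.
by rewrite !mulrzDl -!mulrzA addrA (mulrC b a) (mulrC c a).
Qed.
Fact sqz_mulC : commutative sqz_mul.
Proof. by move=> x y; rewrite /sqz_mul mulrC addrC. Qed.
Fact sqz_mul1 : left_id sqz_one sqz_mul.
Proof. by case=> a u; rewrite /sqz_mul /= mul1r mul0rz addr0. Qed.
Fact sqz_mulDl : left_distributive sqz_mul +%R.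
Proof.
move=> [a u] [b v] [c w]; rewrite /sqz_mul /=; congr pair.
  exact: mulrDl.
by rewrite mulrzDr mulrzDl addrACA.
Qed.
Fact sqz_oner_neq0 : sqz_one != 0 :> sqz.
Proof. by []. Qed.
HB.instance Definition _ := GRing.Zmodule_isComNzRing.Build sqz
  sqz_mulA sqz_mulC sqz_mul1 sqz_mulDl sqz_oner_neq0.

Definition sqz_inj (u : A) : sqz := (0, u).
Fact sqz_inj_additive : additive sqz_inj.
Proof. by move=> u v. Qed.
HB.instance Definition _ := GRing.isZmodMorphism.Build A sqz sqz_inj
  sqz_inj_additive.

Lemma sqz_injK : injective sqz_inj.
Proof. by move=> u v []. Qed.

End SquareZero.

Ltac zmod := apply: (@sqz_injK _); ring.

(** * Discrete integration over the integers *)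

Section IntegerSums.
Variable A : zmodType.
Implicit Types (phi psi : int -> A) (z : int).

(** The discrete antiderivative of [phi] vanishing at 0; the negative branch is chosen so that
    [zsumS] holds at every integer. *)
Definition zsum phi z : A :=
  match z with
  | Posz n => \sum_(i < n) phi i%:Z
  | Negz n => - \sum_(i < n.+1) phi (- i.+1%:Z)
  end.

Lemma zsum0 phi : zsum phi 0 = 0.
Proof. exact: big_ord0. Qed.

Lemma zsumS phi z : zsum phi (z + 1) = zsum phi z + phi z.
Proof.
case: z => [n|[|n]].
- by rewrite -PoszD addn1 /= big_ord_recr.
- by rewrite /= big_ord0 big_ord_recr big_ord0 /= add0r addNr.
- have -> : Negz n.+1 + 1 = Negz n by rewrite !NegzE; lia.
  by rewrite NegzE /= [in RHS]big_ord_recr /= opprD; zmod.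
Qed.

Lemma zsumB phi psi z :
  zsum (fun t => phi t - psi t) z = zsum phi z - zsum psi z.
Proof. by case: z => n /=; rewrite sumrB// opprB addrC opprK. Qed.

Lemma int_shift_invariant (V : Type) (f : int -> V) :
  (forall z, f (z + 1) = f z) -> forall z, f z = f 0.
Proof.
move=> fS; elim/int_rect => // n IH; first by rewrite -IH -addn1 PoszD fS.
by rewrite -IH -(fS (- n.+1%:Z)); congr f; lia.
Qed.

Lemma zsum_telescope psi z :
  zsum (fun t => psi (t + 1) - psi t) z = psi z - psi 0.
Proof.
pose f t := zsum (fun t => psi (t + 1) - psi t) t - psi t.
have fE : forall t, f t = f 0.
  by apply: int_shift_invariant => t; rewrite /f zsumS; zmod.
by have := fE z; rewrite /f zsum0 sub0r => <-; zmod.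
Qed.

End IntegerSums.

(** * Coordinates, basis and truncations of G *)

Section Coordinates.
Implicit Types (x y : finZseq) (i j k n : nat) (z : int).

Lemma finZseq_eqP x y : (forall i, x i = y i) -> x = y.
Proof. by move=> xy; apply: val_inj; apply/funext. Qed.

Definition coord i x : int := x i.
Fact coord_additive i : additive (coord i).
Proof. by []. Qed.
HB.instance Definition _ i :=
  GRing.isZmodMorphism.Build finZseq int (coord i) (coord_additive i).

Lemma finZseqD x y i : (x + y) i = x i + y i. Proof. by []. Qed.
Lemma finZseq0 i : (0 : finZseq) i = 0. Proof. by []. Qed.

Lemma finsupp_bound x : exists n, forall i, (n <= i)%N -> x i = 0.
Proof.
have /asboolP/finite_seqP[s sE] := finZseqP x.
exists (\max_(i <- s) i).+1 => i; apply: contraTeq => xi; rewrite -leqNgt.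
have : i \in s by have : [set i | x i != 0] i by []; rewrite sE.
by move=> /leq_bigmax_seq; apply.
Qed.

Lemma finsupp_seq_bounded (f : nat -> int) n :
  (forall i, (n <= i)%N -> f i = 0) -> f \in finsupp_seq.
Proof.
move=> fn; apply/asboolP; apply: (@sub_finite_set _ _ `I_n) => [i /=|].
  by apply: contraNT; rewrite -leqNgt => /fn ->.
exact: finite_II.
Qed.

Fact basis_subproof k : (fun i => (i == k)%:Z) \in finsupp_seq.
Proof.
apply: (@finsupp_seq_bounded _ k.+1) => i ki.
by rewrite gtn_eqF.
Qed.
Definition basis k := FinZseq (basis_subproof k).

Fact tail_subproof n x : (fun i => if (i < n)%N then 0 else x i) \in finsupp_seq.
Proof.
have [m xm] := finsupp_bound x.
by apply: (@finsupp_seq_bounded _ m) => i mi; rewrite xm// if_same.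
Qed.
Definition tail n x := FinZseq (tail_subproof n x).

Lemma basisMz k z i : (basis k *~ z) i = if i == k then z else 0.
Proof.
by rewrite -[LHS]/(coord i _) raddfMz /coord /=; case: eqP => _; rewrite ?mul0rz// intz.
Qed.

Lemma basisE k i : basis k i = (i == k)%:Z. Proof. by []. Qed.
Lemma tailE n x i : tail n x i = if (i < n)%N then 0 else x i.
Proof. by []. Qed.

Lemma tail0 x : tail 0 x = x.
Proof. exact: finZseq_eqP. Qed.

Lemma tailS n x : tail n.+1 x + basis n *~ x n = tail n x.
Proof.
apply: finZseq_eqP => i; rewrite finZseqD basisMz !tailE ltnS leq_eqVlt.
by case: eqVneq => [->|_] /=; rewrite ?ltnn ?add0r// addr0.
Qed.

Lemma tail_basis_lt n x j : (j < n)%N -> tail n (x + basis j) = tail n x.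
Proof.
move=> jn; apply: finZseq_eqP => i; rewrite !tailE finZseqD basisE.
by case: ltnP => // ni; rewrite gtn_eqF ?addr0// (leq_trans jn).
Qed.

Lemma tail_basis_ge n x j : (n <= j)%N -> tail n (x + basis j) = tail n x + basis j.
Proof.
move=> nj; apply: finZseq_eqP => i; rewrite finZseqD !tailE finZseqD basisE.
by case: ltnP => // ni; rewrite ltn_eqF// (leq_trans ni).
Qed.

(** Clearing the coordinates of [x] one at a time, each by an integer multiple of a basis vector,
    reaches 0 after finitely many steps. *)
Lemma basis_shift_invariant (V : Type) (f : finZseq -> V) :
  (forall k x, f (x + basis k) = f x) -> forall x, f x = f 0.
Proof.
move=> fS x.
have fT n : f (tail n x) = f x.
  elim: n => [|n <-]; first by rewrite tail0.
  rewrite -[in RHS]tailS; set y := tail _ _.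
  rewrite (int_shift_invariant (f := fun z => f (y + basis n *~ z))).
    by rewrite mulr0z addr0.
  by move=> z; rewrite mulrzDr mulr1z addrA fS.
have [n xn] := finsupp_bound x.
rewrite -(fT n); congr f; apply: finZseq_eqP => i; rewrite tailE finZseq0.
by case: ltnP => // /xn.
Qed.

End Coordinates.

(** * Exactness of the Koszul complex of functions on G *)

Section Koszul.
Variable A : zmodType.
Implicit Types (f g : finZseq -> A) (x y : finZseq) (i j k n : nat).

Definition diffb k f x : A := f (x + basis k) - f x.

(* Inverts diffb i on the slab where x_l = 0 for all l < i; the contraction of
   the Koszul complex is the sum of these operators over i. *)
Definition slab i f x : A := zsum (fun z => f (tail i.+1 x + basis i *~ z)) (x i).

Lemma eq_slab i f g : f =1 g -> slab i f =1 slab i g.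
Proof. by move=> /funext ->. Qed.

Lemma slabB i f g x : slab i (fun y => f y - g y) x = slab i f x - slab i g x.
Proof. exact: zsumB. Qed.

Lemma slab0 i f x : x i = 0 -> slab i f x = 0.
Proof. by rewrite /slab => ->; exact: zsum0. Qed.

(** [slab i f x] sees [x] through [tail i.+1 x] and the summation limit [x i]: a shift by [basis k]
    moves only the former if i < k, only the latter if i = k, neither if k < i. *)
Lemma slab_diff_lt i f k x : (i < k)%N -> diffb k (slab i f) x = slab i (diffb k f) x.
Proof.
move=> ik; rewrite /diffb slabB; congr (_ - _).
rewrite /slab finZseqD basisE ltn_eqF// addr0 tail_basis_ge//.
by congr zsum; apply/funext => z; rewrite addrAC.
Qed.

Lemma slab_diff_eq i f x : diffb i (slab i f) x = f (tail i x).
Proof.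
rewrite /diffb /slab finZseqD basisE eqxx tail_basis_lt// zsumS.
by rewrite tailS addrC addKr.
Qed.

Lemma slab_diff_gt i f k x : (k < i)%N -> diffb k (slab i f) x = 0.
Proof.
move=> ki; rewrite /diffb /slab finZseqD basisE gtn_eqF// addr0.
by rewrite tail_basis_lt ?subrr// ltnW.
Qed.

Lemma slab_telescope i f x : slab i (diffb i f) x = f (tail i x) - f (tail i.+1 x).
Proof.
rewrite /slab /diffb -(tailS i x) -[in X in _ - X](addr0 (tail i.+1 x)).
rewrite -(mulr0z (basis i)).
rewrite -(zsum_telescope (fun z => f (tail i.+1 x + basis i *~ z))).
by congr zsum; apply/funext => z; rewrite mulrzDr mulr1z addrA.
Qed.

Lemma sum_tail k f x :
  \sum_(i < k) (f (tail i x) - f (tail i.+1 x)) = f x - f (tail k x).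
Proof.
rewrite -(big_mkord xpredT (fun i => f (tail i x) - f (tail i.+1 x))).
rewrite (@telescope_sumr_eq A 0 k (fun i => - f (tail i x))) => // [|i _].
  by rewrite tail0; zmod.
by rewrite opprK addrC.
Qed.

Lemma diffb_sum (I : finType) (F : I -> finZseq -> A) k x :
  diffb k (fun y => \sum_i F i y) x = \sum_i diffb k (F i) x.
Proof. by rewrite /diffb sumrB. Qed.

Lemma sum_ord_prefix (F : nat -> A) j k : (j < k)%N ->
  (forall i, (j < i)%N -> F i = 0) -> \sum_(i < k) F i = \sum_(i < j) F i + F j.
Proof.
move=> jk F0; rewrite -(subnKC jk) big_split_ord /= [X in _ + X]big1 => [|i _].
  by rewrite addr0 big_ord_recr.
by rewrite F0// ltnS leq_addr.
Qed.

Lemma koszul_exact2 (f : nat -> nat -> finZseq -> A) :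
  (forall i j k x, (i < j < k)%N ->
     diffb i (f j k) x - diffb j (f i k) x + diffb k (f i j) x = 0) ->
  exists v : nat -> finZseq -> A, forall j k x, (j < k)%N ->
    diffb j (v k) x - diffb k (v j) x = f j k x.
Proof.
move=> fclosed; exists (fun j x => \sum_(i < j) slab i (f i j) x) => j k x jk.
(* Terms with i > j vanish, i = j gives [f j k (tail j x)], and by closedness those with i < j
   telescope to [f j k x - f j k (tail j x)]. *)
rewrite !diffb_sum (sum_ord_prefix (F := fun i => diffb j (slab i (f i k)) x) jk).
  2: by move=> i; exact: slab_diff_gt.
rewrite slab_diff_eq addrAC -sumrB.
rewrite (eq_bigr (fun i : 'I_j =>
    f j k (tail i x) - f j k (tail i.+1 x))) => [|i _]; last first.
  have ij := ltn_ord i; rewrite !slab_diff_lt// -?slabB ?(ltn_trans ij)//.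
  rewrite -slab_telescope; apply: eq_slab => y.
  have := fclosed i j k y; rewrite ij jk => /(_ isT) e.
  by apply/eqP; rewrite -subr_eq0 -oppr_eq0; apply/eqP; rewrite -e; zmod.
by rewrite sum_tail subrK.
Qed.

(* Meant for F vanishing wherever x does: the chosen bound is then irrelevant. *)
Definition fsum x (F : nat -> A) : A := \sum_(i < sval (cid (finsupp_bound x))) F i.

Lemma fsumE n x F : (forall i, (n <= i)%N -> x i = 0) ->
  (forall i, x i = 0 -> F i = 0) -> fsum x F = \sum_(i < n) F i.
Proof.
rewrite /fsum; case: cid => m /= xm xn F0.
have main a b : (forall i, (a <= i)%N -> x i = 0) -> (a <= b)%N ->
    \sum_(i < b) F i = \sum_(i < a) F i.
  move=> xa ab; rewrite -(subnKC ab) big_split_ord /= [X in _ + X]big1 ?addr0//.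
  by move=> i _; rewrite F0// xa// leq_addr.
by case: (leqP m n) => [|/ltnW] ?; [rewrite (main m n)|rewrite (main n m)].
Qed.

Lemma fsum_bound x (y : finZseq) : exists n,
  (forall i, (n <= i)%N -> x i = 0) /\ (forall i, (n <= i)%N -> y i = 0).
Proof.
have [m xm] := finsupp_bound x; have [n yn] := finsupp_bound y.
by exists (maxn m n); split=> i; rewrite geq_max => /andP[? ?]; [exact: xm|exact: yn].
Qed.

Lemma koszul_exact1 (f : nat -> finZseq -> A) :
  (forall j k x, (j < k)%N -> diffb j (f k) x = diffb k (f j) x) ->
  exists w : finZseq -> A, forall k x, diffb k w x = f k x.
Proof.
move=> fclosed; exists (fun x => fsum x (fun i => slab i (f i) x)) => k x.
(* One bound past [k] for both [x] and [x + basis k], so that the two sums have the same range and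
   contain the term i = k. *)
have [m [xm ym]] := fsum_bound x (x + basis k); pose n := maxn m k.+1.
have {}xm i : (n <= i)%N -> x i = 0 by rewrite geq_max => /andP[/xm].
have {}ym i : (n <= i)%N -> (x + basis k) i = 0 by rewrite geq_max => /andP[/ym].
have kn : (k < n)%N by rewrite leq_max leqnn orbT.
rewrite /diffb (fsumE ym) => [|i xi]; last exact: slab0.
rewrite (fsumE xm) => [|i xi]; last exact: slab0.
rewrite -sumrB (sum_ord_prefix (F := fun i => diffb k (slab i (f i)) x) kn).
  2: by move=> i; exact: slab_diff_gt.
rewrite slab_diff_eq.
rewrite (eq_bigr (fun i : 'I_k =>
    f k (tail i x) - f k (tail i.+1 x))) => [|i _]; last first.
  have ik := ltn_ord i; rewrite -[LHS]/(diffb k (slab i (f i)) x) slab_diff_lt//.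
  by rewrite -(slab_telescope i (f k)); apply: eq_slab => y; rewrite -fclosed.
by rewrite sum_tail subrK.
Qed.

End Koszul.

(** * Third cohomology of G *)

Section Cocycles.
Variable A : zmodType.
Implicit Types (x y p q r : finZseq) (i j k : nat).

Lemma diffbC i j (f : finZseq -> A) x :
  diffb i (diffb j f) x = diffb j (diffb i f) x.
Proof. by rewrite /diffb (addrAC x); zmod. Qed.

Lemma basis_ext (f g : finZseq -> A) : f 0 = g 0 ->
  (forall k x, diffb k f x = diffb k g x) -> f =1 g.
Proof.
move=> fg0 fg x; apply/eqP; rewrite -subr_eq0; apply/eqP.
rewrite (@basis_shift_invariant _ (fun x => f x - g x)); first by rewrite fg0 subrr.
move=> k y; have := fg k y; rewrite /diffb => e.
apply/eqP; rewrite -subr_eq0; apply/eqP.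
transitivity ((f (y + basis k) - f y) - (g (y + basis k) - g y)); first by zmod.
by rewrite e subrr.
Qed.

Definition pairing (a : nat -> A) x : A := fsum x (fun k => a k *~ x k).

Lemma pairingD a x y : pairing a (x + y) = pairing a x + pairing a y.
Proof.
have [m [xm ym]] := fsum_bound x y.
have xym i : (m <= i)%N -> (x + y) i = 0.
  by move=> mi; rewrite finZseqD xm// ym// addr0.
rewrite /pairing (fsumE xm) => [|i ->//].
rewrite (fsumE ym) => [|i ->//]; rewrite (fsumE xym) => [|i ->//].
by rewrite -big_split; apply: eq_bigr => i _; rewrite finZseqD mulrzDr.
Qed.

Lemma pairing0 a : pairing a 0 = 0.
Proof. by apply: (addrI (pairing a 0)); rewrite -pairingD !addr0. Qed.

Lemma pairing_basis a k : pairing a (basis k) = a k.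
Proof.
rewrite /pairing (fsumE (n := k.+1)) => [|i ki|i ->//]; last first.
  by rewrite basisE gtn_eqF.
rewrite big_ord_recr /= eqxx mulr1z big1 ?add0r// => i _.
by rewrite ltn_eqF.
Qed.

(** The cut-off at [n] builds the order i < j < k into the cochains: only differences in directions
    below [n] survive. *)
Definition partial_pairing n (a : nat -> A) x : A := \sum_(i < n) a i *~ x i.

Lemma partial_pairingD n a x y :
  partial_pairing n a (x + y) = partial_pairing n a x + partial_pairing n a y.
Proof. by rewrite -big_split; apply: eq_bigr => i _; rewrite finZseqD mulrzDr. Qed.

Lemma diffb_partial_pairing n a k x :
  diffb k (partial_pairing n a) x = if (k < n)%N then a k else 0.
Proof.
rewrite /diffb partial_pairingD addrC addKr /partial_pairing; case: ltnP => kn.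
  rewrite (sum_ord_prefix (F := fun i => a i *~ basis k i) kn) => [|i ki].
    rewrite big1 => [|i _]; first by rewrite add0r basisE eqxx.
    by rewrite basisE ltn_eqF.
  by rewrite basisE gtn_eqF.
by apply: big1 => i _; rewrite basisE ltn_eqF// (leq_trans (ltn_ord i)).
Qed.

Lemma diffb_pairing a k x : diffb k (pairing a) x = a k.
Proof. by rewrite /diffb pairingD pairing_basis addrC addKr. Qed.

Theorem cocycle3_trilinear (c : finZseq -> finZseq -> finZseq -> A) :
  (forall p q r s,
     c q r s - c (p + q) r s + c p (q + r) s - c p q (r + s) + c p q r = 0) ->
  exists (b : finZseq -> finZseq -> A) (l : nat -> nat -> nat -> A),
  forall p q r, c p q r = b q r - b (p + q) r + b p (q + r) - b p q +
    pairing (fun k => \sum_(j < k) \sum_(i < j) (l i j k *~ r i) *~ q j) p.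
Proof.
move=> cocycle.
have ce p q r s : c (p + q) r s = c q r s + c p (q + r) s - c p q (r + s) + c p q r.
  by apply/eqP; rewrite eq_sym -subr_eq0 -(cocycle p q r s); apply/eqP; zmod.
have c0 p q r : c 0 (p + q) r - c 0 p (q + r) + c 0 p q = 0.
  by rewrite -[RHS](cocycle 0 p q r) add0r; zmod.
(* The first argument of [c] becomes the base point. The cocycle identity at [(basis i, x, p, q)]
   makes its difference a bar coboundary; the [c 0] part has zero coboundary by [c0]. *)
pose d i p x := c (basis i) x p - c 0 x p.
have dE i x p q :
    diffb i (fun y => c y p q) x = d i q (x + p) - d i (p + q) x + d i p x.
  rewrite /diffb /d (addrC x (basis i)) (ce (basis i) x p q).
  by rewrite -[LHS]subr0 -(c0 x p q); zmod.
pose dd i j p x := diffb i (d j p) x - diffb j (d i p) x.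
(* By [dd0] below, [dd i j] is a 1-cocycle with values in the functions on G, hence the coboundary
   of its values at base point 0. *)
pose u i j x := dd i j x 0.
have dd0 i j p q x : dd i j q (x + p) - dd i j (p + q) x + dd i j p x = 0.
  have e k l : diffb k (diffb l (fun y => c y p q)) x =
      diffb k (d l q) (x + p) - diffb k (d l (p + q)) x + diffb k (d l p) x.
    rewrite (_ : diffb l _ = fun y => d l q (y + p) - d l (p + q) y + d l p y).
      by rewrite /diffb (addrAC x p); zmod.
    by apply/funext => y; exact: dE.
  have := diffbC i j (fun y => c y p q) x; rewrite !e => /eqP.
  by rewrite -subr_eq0 => /eqP <-; rewrite /dd; zmod.
have ddE i j p x : dd i j p x = u i j (x + p) - u i j x.
  by apply/eqP; rewrite -subr_eq0 -(dd0 i j x p 0) add0r /u; apply/eqP; zmod.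
pose kappa i j k x := diffb i (u j k) x - diffb j (u i k) x + diffb k (u i j) x.
pose l i j k := kappa i j k 0.
(* [kappa i j k x - kappa i j k 0] is an alternating sum of second differences of [d], which cancel
   because differences commute. *)
have kappaE i j k x : kappa i j k x = l i j k.
  have e a b e : diffb a (u b e) x - diffb a (u b e) 0 =
      diffb a (diffb b (d e x)) 0 - diffb a (diffb e (d b x)) 0.
    transitivity (diffb a (dd b e x) 0); last by rewrite /diffb /dd /diffb; zmod.
    by rewrite {3}/diffb !ddE /diffb !add0r (addrC x); zmod.
  apply/eqP; rewrite -subr_eq0; apply/eqP; rewrite /l /kappa.
  transitivity ((diffb i (u j k) x - diffb i (u j k) 0)
     - (diffb j (u i k) x - diffb j (u i k) 0)
     + (diffb k (u i j) x - diffb k (u i j) 0)); first by zmod.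
  rewrite !e (diffbC j i) (diffbC k i) (diffbC k j); zmod.
(* [u0], [d0] form the zigzag of the trilinear cocycle attached to l; they are
   subtracted on the way back up. *)
pose u0 j k := partial_pairing j (fun i => l i j k).
have u0D j k x y : u0 j k (x + y) = u0 j k x + u0 j k y by exact: partial_pairingD.
have diffb_u0 i j k x : diffb i (u0 j k) x = if (i < j)%N then l i j k else 0.
  exact: diffb_partial_pairing.
have [v vE] : exists v : nat -> finZseq -> A, forall j k x, (j < k)%N ->
    diffb j (v k) x - diffb k (v j) x = u j k x - u0 j k x.
  apply: koszul_exact2 => i j k x /andP[ij jk].
  have e a b e : diffb a (fun x => u b e x - u0 b e x) x =
      diffb a (u b e) x - diffb a (u0 b e) x by rewrite /diffb; zmod.
  rewrite !e !diffb_u0 ij ltnNge (ltnW ij) /= ltnNge (ltnW (ltn_trans ij jk)) /=.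
  transitivity (kappa i j k x - l i j k); first by rewrite /kappa; zmod.
  by rewrite kappaE subrr.
(* Subtracting the coboundary of [v] turns the commutator [dd j k p] into the constant [u0 j k p],
   which [d0] reproduces; so [d' - d0] is closed. *)
pose d' k p x := d k p x - (v k (x + p) - v k x).
pose d0 k p := partial_pairing k (fun j => u0 j k p).
have d0D k p x y : d0 k p (x + y) = d0 k p x + d0 k p y by exact: partial_pairingD.
have diffb_d0 i k p x : diffb i (d0 k p) x = if (i < k)%N then u0 i k p else 0.
  exact: diffb_partial_pairing.
have /choice[w wE] p : exists w : finZseq -> A, forall k x,
    diffb k w x = d' k p x - d0 k p x.
  apply: koszul_exact1 => j k x jk.
  have e a b : diffb a (fun x => d' b p x - d0 b p x) x =
      diffb a (d b p) x - (diffb a (v b) (x + p) - diffb a (v b) x)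
      - diffb a (d0 b p) x.
    by rewrite /d' /diffb (addrAC x p); zmod.
  rewrite !e !diffb_d0 jk ltnNge (ltnW jk) /=.
  apply/eqP; rewrite -subr_eq0; apply/eqP.
  transitivity (dd j k p x - (diffb j (v k) (x + p) - diffb k (v j) (x + p))
     + (diffb j (v k) x - diffb k (v j) x) - u0 j k p); first by rewrite /dd; zmod.
  by rewrite !vE// ddE u0D; zmod.
(* With the coboundary of [w] removed, the differences in [x] are the coboundary of [d0], which
   additivity of [u0] and [d0] reduces to the constant [d0 k q p]; so [b] is affine in [x]. *)
pose b x p q := c x p q - (w q (x + p) - w (p + q) x + w p x).
pose mu (p q : finZseq) k := \sum_(j < k) \sum_(i < j) (l i j k *~ q i) *~ p j.
have bE p q x : b x p q = b 0 p q + pairing (mu p q) x.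
  apply: (basis_ext (f := fun x => b x p q)
    (g := fun x => b 0 p q + pairing (mu p q) x)) => [|k y].
    by rewrite pairing0 addr0.
  transitivity (diffb k (pairing (mu p q)) y); last by rewrite /diffb; zmod.
  transitivity (d0 k q (y + p) - d0 k (p + q) y + d0 k p y).
    transitivity (diffb k (fun x => c x p q) y - (diffb k (w q) (y + p) -
        diffb k (w (p + q)) y + diffb k (w p) y)).
      by rewrite /diffb /b (addrAC y p); zmod.
    by rewrite dE !wE /d' (addrA y p q); zmod.
  rewrite diffb_pairing d0D.
  transitivity (d0 k q p - (d0 k (p + q) y - d0 k p y - d0 k q y)); first by zmod.
  rewrite [X in _ - X](_ : _ = 0) ?subr0.
    by rewrite /d0 /mu; apply: eq_bigr => j _; rewrite -mulrz_suml.
  rewrite /d0 /partial_pairing -!sumrB big1// => j _; rewrite u0D mulrzDl; zmod.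
(* At base point [p], the [w] terms removed from [c p q r] are restored by the other three terms of
   the coboundary of [b 0]; the [c 0] terms cancel by [c0]. *)
exists (b 0), l => p q r; rewrite -/(mu q r).
transitivity (b p q r - b 0 (p + q) r + b 0 p (q + r) - b 0 p q).
  2: by rewrite (bE q r p); zmod.
by rewrite -[LHS]subr0 -[X in _ - X](c0 p q r) /b !add0r (addrA p q r); zmod.
Qed.

End Cocycles.

(** * Pullback to H *)

Section Pullback.
Variable A : zmodType.
Implicit Types (x y z : extH).

Lemma pairingB (a1 a2 : nat -> A) p :
  pairing (fun k => a1 k - a2 k) p = pairing a1 p - pairing a2 p.
Proof. by rewrite /pairing /fsum -sumrB; apply: eq_bigr => k _; rewrite mulrzBl. Qed.

(* On H, the form (g, h) |-> g_j h_i with i < j is minus the coboundary of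
   m_ij - g_i g_j. *)
Theorem pullback_pi0_coboundary (c : finZseq -> finZseq -> finZseq -> A) :
  (forall p q r s,
     c q r s - c (p + q) r s + c p (q + r) s - c p q (r + s) + c p q r = 0) ->
  exists b : extH -> extH -> A, forall x y z : extH,
    b y z - b (x * y)%g z + b x (y * z)%g - b x y = c (pi0 x) (pi0 y) (pi0 z).
Proof.
move=> /cocycle3_trilinear[b [l cE]].
pose nu y k := \sum_(j < k) \sum_(i < j) l i j k *~ (y.1 i j - y.2 i * y.2 j).
pose mu (p q : finZseq) k := \sum_(j < k) \sum_(i < j) (l i j k *~ q i) *~ p j.
(* Written with subtractions only, so that [pairingB] alone splits it. *)
have nuM y z k : nu (y * z)%g k = nu y k - mu y.2 z.2 k - (0 - nu z k).
  rewrite sub0r opprK /nu /mu -sumrB -big_split; apply: eq_bigr => j _ /=.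
  rewrite -sumrB -big_split; apply: eq_bigr => i _ /=.
  rewrite -mulrzA -mulrzBr -mulrzDr; congr (_ *~ _).
  rewrite -[LHS]/(y.1 i j + z.1 i j + (if (i < j)%N then y.2 i * z.2 j else 0)
    - (y.2 i + z.2 i) * (y.2 j + z.2 j)) ltn_ord; ring.
(* The subtracted term is a cup product of the additive [x.2] with [nu]; its coboundary pairs [x.2]
   with [nu (y * z) - nu y - nu z], which is minus [mu y.2 z.2], hence the sign. *)
exists (fun x y => b x.2 y.2 - pairing (nu y) x.2) => x y z.
rewrite cE -/(mu y.2 z.2) /pi0.
rewrite (_ : nu (y * z)%g = fun k => nu y k - mu y.2 z.2 k - (0 - nu z k)); last first.
  by apply/funext => k; exact: nuM.
rewrite !pairingB -[(x * y)%g.2]/(x.2 + y.2) -[(y * z)%g.2]/(y.2 + z.2) pairingD.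
have -> : pairing (fun _ => 0 : A) x.2 = 0.
  by rewrite /pairing /fsum big1// => k _; rewrite mul0rz.
zmod.
Qed.

End Pullback.

Section CircleZmodule.
Variable R : realType.

(** T in additive notation, with operations convertible to those of [circle], so that multiplicative
    and additive coboundary formulas agree by computation. *)
Definition circle_add : Type := circle R.
HB.instance Definition _ := Choice.on circle_add.
HB.instance Definition _ := @GRing.isZmodule.Build circle_add
  (circle_one R) (@circle_inv R) (@circle_mul R)
  (@circle_mulA R) (@circle_mulC R) (@circle_mul1 R) (@circle_mulV R).

(** Serves both claims, with [phi] the identity of G or the given surjection onto K: cocycles of K
    pull back along [phi] to cocycles of G. *)
Lemma pullback_Z3_sub_B3 (K : groupType) (pi : extH -> K)
    (phi : finZseq -> K) : {morph phi : x y / x + y >-> (x * y)%g} ->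
  (forall x, pi x = phi (pi0 x)) -> pullback3 pi @` @Z3 R K `<=` @B3 R extH.
Proof.
move=> phiD piE _ [c cZ <-].
pose c' p q r : circle_add := c (phi p) (phi q) (phi r).
have [p q r s|b bE] := @pullback_pi0_coboundary circle_add c'.
  rewrite /c' !phiD; exact: cZ.
exists b => //; apply/funext => x; apply/funext => y; apply/funext => z.
by rewrite /pullback3 !piE; exact: bE.
Qed.

End CircleZmodule.

(** * Amenability *)

Lemma ultra_fmap (T U : Type) (f : T -> U) (F : set_system T) :
  UltraFilter F -> UltraFilter (f @ F).
Proof.
move=> FU; split; first exact: fmap_proper_filter.
move=> G GF FG; rewrite predeqE => A; split; last exact: FG.
move=> GA; have [//|FA] := in_ultra_setVsetC (f @^-1` A) FU.
have : G (A `&` ~` A) by apply: filterI => //; apply: FG.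
by rewrite setICr => /filter_not_empty.
Qed.

Section BoundedFunctions.
Variables (R : realType) (T : Type).
Implicit Types f g : T -> R.

Lemma bounded_funP f : bounded_fun f <-> exists C, forall x, `|f x| <= C.
Proof.
split=> [[C [_ fC]]|[C fC]].
  by exists (C + 1) => x; apply: fC => //; rewrite ltrDl.
by exists C; split=> [|a Ca x _]; [exact: num_real|exact: le_trans (fC x) (ltW Ca)].
Qed.

End BoundedFunctions.

Section Averages.
Variables (R : realType) (V : zmodType).
Implicit Types (f g : V -> R) (v x h : V) (n : nat) (s : seq V).

Definition avg n v f x : R := n.+1%:R^-1 * \sum_(k < n.+1) f (x + v *+ k).

Definition avgs n s f : V -> R := foldr (avg n) f s.

Lemma avgs_cst n s (a : R) : avgs n s (cst a) = cst a.
Proof.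
elim: s => //= v s ->; apply/funext => x /=.
by rewrite /avg sumr_const card_ord -(mulr_natl a) mulKf// pnatr_eq0.
Qed.

Lemma avgs_linear n s a f g x :
  avgs n s (fun y => a * f y + g y) x = a * avgs n s f x + avgs n s g x.
Proof.
elim: s x => //= v s IH x; rewrite /avg mulrCA -mulrDr; congr (_ * _).
by rewrite mulr_sumr -big_split; apply: eq_bigr => k _; exact: IH.
Qed.

Lemma avgs_translate n s f h x : avgs n s (fun y => f (h + y)) x = avgs n s f (h + x).
Proof.
elim: s x => //= v s IH x; rewrite /avg.
by congr (_ * _); apply: eq_bigr => k _; rewrite IH addrA.
Qed.

Lemma avgs_ge0 n s f : (forall x, 0 <= f x) -> forall x, 0 <= avgs n s f x.
Proof.
move=> f0; elim: s => //= v s IH x.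
by rewrite mulr_ge0 ?invr_ge0// sumr_ge0.
Qed.

Lemma avg_le n v f (C : R) :
  (forall x, `|f x| <= C) -> forall x, `|avg n v f x| <= C.
Proof.
move=> fC x; rewrite /avg normrM ger0_norm ?invr_ge0// mulrC ler_pdivrMr//.
apply: le_trans (ler_norm_sum _ _ _) _.
apply: le_trans (ler_sum _ (fun k _ => fC _)) _.
by rewrite sumr_const card_ord mulr_natr.
Qed.

Lemma avgs_le n s f (C : R) :
  (forall x, `|f x| <= C) -> forall x, `|avgs n s f x| <= C.
Proof. by move=> fC; elim: s => //= v s; exact: avg_le. Qed.

(** The sum telescopes to its two end terms, each bounded by [C]. *)
Lemma avg_translate_diff n v f (C : R) : (forall x, `|f x| <= C) ->
  forall x, `|avg n v (fun y => f (v + y) - f y) x| <= 2 * C / n.+1%:R.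
Proof.
move=> fC x; rewrite /avg normrM ger0_norm ?invr_ge0// mulrC ler_pM2r ?invr_gt0//.
rewrite -(big_mkord xpredT (fun k => f (v + (x + v *+ k)) - f (x + v *+ k))).
rewrite (@telescope_sumr_eq _ 0 n.+1 (fun k => f (x + v *+ k))) => // [|k _].
  2: by rewrite addrCA -mulrS.
by apply: le_trans (ler_normB _ _) _; rewrite mulrDl mul1r lerD.
Qed.

(** Averages commute with translations and do not increase bounds, so the averaging along [v] alone
    gives the estimate. *)
Lemma avgs_translate_diff n s v f (C : R) : v \in s -> (forall x, `|f x| <= C) ->
  forall x, `|avgs n s (fun y => f (v + y) - f y) x| <= 2 * C / n.+1%:R.
Proof.
move=> + fC; elim: s => //= w s IH; rewrite inE => /predU1P[<- x|vs]; last first.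
  exact/avg_le/IH.
rewrite (_ : avgs n s _ = fun y => avgs n s f (v + y) - avgs n s f y).
  exact/avg_translate_diff/avgs_le.
apply/funext => y; rewrite -avgs_translate addrC -mulN1r -avgs_linear.
by congr (avgs n s _ y); apply/funext => z; rewrite mulN1r addrC.
Qed.

End Averages.

(* The means of f over the boxes {sum_(i < n) k_i e_i | 0 <= k_i <= n}, counted
   with multiplicity, are asymptotically invariant; an ultrafilter limit is
   invariant. *)
Lemma countable_abelian_amenable (R : realType) (V : zmodType) :
  countable [set: V] -> amenable R (Algebra.to_multiplicative V).
Proof.
move=> /countable_injP[pick pick_inj].
(* An enumeration of V; numbers that code no element are sent to 0. *)
have [e eP] : exists e : nat -> V, forall v, exists n, e n = v.
  have /choice[e eP] n : exists v, forall w, pick w = n -> v = w.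
    have [[w wn]|nw] := pselect (exists w, pick w = n).
      by exists w => w' w'n; apply: pick_inj; rewrite ?inE// wn.
    by exists 0 => w wn; case: nw; exists w.
  by exists e => v; exists (pick v); exact: eP.
have [U [UU ooU]] := ultraFilterLemma (_ : ProperFilter \oo).
pose m (f : V -> R) n := avgs n (mkseq e n) f 0.
have mC f C : (forall x, `|f x| <= C) -> forall n, `|m f n| <= C.
  by move=> fC n; exact: avgs_le.
have m_cvg f : bounded_fun f -> cvg (m f @ U).
  move=> /bounded_funP[C fC].
  have := @segment_compact R (- C) C; rewrite compact_ultra.
  move=> /(_ (m f @ U) (ultra_fmap _ UU))[|l [_ ml]]; last by apply/cvg_ex; exists l.
  by apply: (@filterE _ U) => n /=; rewrite in_itv /= -ler_norml; exact: mC.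
exists (fun f => lim (m f @ U)); split.
- rewrite (_ : m (cst 1) = cst 1) ?lim_cst//.
  by apply/funext => n; rewrite /m avgs_cst.
- move=> f bf f0; apply: limr_ge; first exact: m_cvg.
  by apply: filterE => n; exact: avgs_ge0.
- move=> a f g bf bg; apply: cvg_lim => //.
  rewrite (_ : m _ = fun n => a * m f n + m g n).
    by apply: cvgD; [apply: cvgMr|]; exact: m_cvg.
  by apply/funext => n; exact: avgs_linear.
- move=> h f bf; apply: cvg_lim => //.
  rewrite (_ : m _ = fun n => (m (fun x => f (h + x)) n - m f n) + m f n); last first.
    by apply/funext => n; rewrite subrK.
  rewrite -[X in _ --> X]add0r; apply: cvgD; last exact: m_cvg.
  (* [U] refines [\oo], so an ordinary limit suffices. Once n > k, [h = e k] is among the averaged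
     directions and the difference is at most 2C/(n+1). *)
  apply: cvg_trans (_ : _ @ \oo --> _); first exact: cvg_app.
  have /bounded_funP[C fC] := bf; have [k ek] := eP h.
  apply/norm_cvg0P; apply: (@squeeze_cvgr _ _ _ _ (cst 0)
    (fun n => 2 * C * n.+1%:R^-1)).
  + near=> n; rewrite normr_ge0 /=.
    have -> : m (fun x => f (h + x)) n - m f n =
        avgs n (mkseq e n) (fun x => f (h + x) - f x) 0.
      rewrite /m addrC -mulN1r -avgs_linear.
      by congr (avgs _ _ _ _); apply/funext => z; rewrite mulN1r addrC.
    apply: avgs_translate_diff => //; rewrite -ek; apply/mapP; exists k => //.
    by rewrite mem_iota /= add0n; near: n; exact: nbhs_infty_gt.
  + exact: cvg_cst.
  + rewrite -[X in _ --> X](mulr0 (2 * C)); apply: cvgMr; exact: cvg_harmonic.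
Unshelve. all: by end_near.
Qed.

Section Means.
Variables (R : realType).

(** Positivity of the mean applied to [C + f] and [C - f]. *)
Lemma mean_le (K : groupType) (mu : (K -> R) -> R) : left_invariant_mean mu ->
  forall (f : K -> R) C, (forall x, `|f x| <= C) -> `|mu f| <= C.
Proof.
move=> [mu1 mu_ge0 mu_lin _].
have bcst (a : R) : bounded_fun (cst a : K -> R).
  by apply/bounded_funP; exists `|a|.
have mu0 : mu (cst 0) = 0.
  (* Linearity comes in the form [a * f + g]; a = -1 and f = g = 1 give the value at 0. *)
  have := mu_lin (-1) (cst 1) (cst 1) (bcst 1) (bcst 1).
  rewrite mu1 [in RHS]mulN1r [in RHS]addNr => e; rewrite -[RHS]e.
  by congr mu; apply/funext => x /=; rewrite mulN1r addNr.
have mu_cst a : mu (cst a) = a.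
  have := mu_lin a (cst 1) (cst 0) (bcst 1) (bcst 0).
  rewrite mu1 mu0 [in RHS]mulr1 [in RHS]addr0 => e; rewrite -[RHS]e.
  by congr mu; apply/funext => x /=; rewrite mulr1 addr0.
have main (f : K -> R) a C : `|a| = 1 -> (forall x, `|f x| <= C) -> 0 <= a * mu f + C.
  move=> a1 fC; have bf : bounded_fun f by apply/bounded_funP; exists C.
  rewrite -[X in _ + X]mu_cst -mu_lin//; apply: mu_ge0 => [|x].
    apply/bounded_funP; exists (C + C) => x.
    apply: le_trans (ler_normD _ _) _; rewrite normrM a1 mul1r.
    by rewrite lerD// ger0_norm// (le_trans _ (fC x)).
  have : `|a * f x| <= C by rewrite normrM a1 mul1r.
  by rewrite ler_norml /cst; lra.
move=> f C fC; rewrite ler_norml.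
have := main f 1 C (normr1 _) fC; have := main f (-1) C (normrN1 _) fC.
by rewrite mulN1r mul1r; lra.
Qed.

Lemma extH_amenable :
  amenable R (Algebra.to_multiplicative upperZmx) ->
  amenable R (Algebra.to_multiplicative finZseq) -> amenable R extH.
Proof.
move=> [mu mean_mu] [nu mean_nu].
have [mu1 mu_ge0 mu_lin mu_inv] := mean_mu; have [nu1 nu_ge0 nu_lin nu_inv] := mean_nu.
pose sec (f : extH -> R) g m := f (m, g).
have sec_b f g : bounded_fun f -> bounded_fun (sec f g).
  by move=> /bounded_funP[C fC]; apply/bounded_funP; exists C => m; exact: fC.
have int_b f : bounded_fun f -> bounded_fun (fun g => mu (sec f g)).
  move=> /bounded_funP[C fC]; apply/bounded_funP; exists C => g.
  by apply: (mean_le mean_mu) => m; exact: fC.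
exists (fun f => nu (fun g => mu (sec f g))); split.
- by rewrite -[RHS]nu1; congr nu; apply/funext => g; exact: mu1.
- move=> f bf f0; apply: nu_ge0 => [|g]; first exact: int_b.
  by apply: mu_ge0 => [|m]; [exact: sec_b|exact: f0].
- move=> a f1 f2 bf1 bf2; rewrite -nu_lin; [|exact: int_b|exact: int_b].
  by congr nu; apply/funext => g; rewrite -mu_lin //; exact: sec_b.
- move=> h f bf; rewrite -(nu_inv h.2 (fun g => mu (sec f g))); last exact: int_b.
  congr nu; apply/funext => g.
  (* Left translation by [h] carries the fibre over [g] to that over [h.2 + g], shifting it by
     [h.1 + nM h.2 g]; the shift varies with [g], but [mu] absorbs it fibre by fibre. *)
  rewrite -(mu_inv (h.1 + nM h.2 g) (sec f (h.2 + g))); last exact: sec_b.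
  congr mu; apply/funext => m; rewrite /sec; congr f.
  by rewrite -[LHS]/(h.1 + m + nM h.2 g, h.2 + g) addrAC.
Qed.

End Means.

(** * Countability *)

(** The list of pairs (index, value) over a finite list containing the support determines the
    element, and such lists are countable. *)
Lemma countable_finsupp (I : countType) (F : Type) (val : F -> I -> int) :
  injective val -> (forall x, finite_set [set i | val x i != 0]) ->
  countable [set: F].
Proof.
move=> val_inj fin.
have /choice[s sE] x : exists s : seq I, forall i, val x i != 0 -> i \in s.
  have /finite_seqP[s sE] := fin x; exists s => i xi.
  by have : [set i | val x i != 0] i by []; rewrite sE.
pose code x := [seq (i, val x i) | i <- s x].
apply/countable_injP; exists (choice.pickle \o code) => x y _ _.
move=> /(pcan_inj choice.pickleK) xy; apply: val_inj; apply/funext => i.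
wlog xi : x y xy / val x i != 0.
  move=> W; have [x0|x0] := eqVneq (val x i) 0; last exact: W.
  have [y0|y0] := eqVneq (val y i) 0; first by rewrite x0 y0.
  by apply/esym; exact: W.
have : (i, val x i) \in code x by apply/mapP; exists i => //; exact: sE.
by rewrite xy => /mapP[j _ [-> ->]].
Qed.

Lemma finZseq_countable : countable [set: finZseq].
Proof.
apply: (@countable_finsupp nat _ finZseq_val) => [|x]; first exact: val_inj.
by have /asboolP := finZseqP x.
Qed.

Lemma upperZmx_countable : countable [set: upperZmx].
Proof.
apply: (@countable_finsupp _ _ (fun (m : upperZmx) (jk : nat * nat) => m jk.1 jk.2)).
  move=> m n mn; apply: val_inj; apply/funext => j; apply/funext => k.
  exact: (congr1 (fun f => f (j, k)) mn).
by move=> m; have /asboolP[] := upperZmxP m.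
Qed.

Lemma extH_countable : countable [set: extH].
Proof.
rewrite -setXTT; apply: countableX; first exact: upperZmx_countable.
exact: finZseq_countable.
Qed.

(* [Algebra.to_multiplicative V] is the additive group V in multiplicative notation. *)
Theorem theorem3p2 (R : realType) :
  universal_resolution R (pi0 : extH -> Algebra.to_multiplicative finZseq) /\
  (forall (K : zmodType) (pi : {additive finZseq -> K}),
     countable [set: K] ->
     set_surj [set: finZseq] [set: K] pi ->
     universal_resolution R (pi \o pi0 : extH -> Algebra.to_multiplicative K)).
Proof.
have amenH : amenable R extH.
  apply: extH_amenable; apply: countable_abelian_amenable.
    exact: upperZmx_countable.
  exact: finZseq_countable.
split=> [|K pi _ pi_surj]; split=> //; try exact: extH_countable.
- by move=> g _; exists (0, g).
- by apply: (@pullback_Z3_sub_B3 R (Algebra.to_multiplicative finZseq) _ id) => // x y.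
- by move=> x y; exact: (raddfD pi).
- by move=> k /pi_surj[g _ <-]; exists (0, g).
- apply: (@pullback_Z3_sub_B3 R (Algebra.to_multiplicative K) _ pi) => // x y.
  exact: (raddfD pi).
Qed.
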